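(* Assume $\Phi$ is 1-strongly convex with respect to a norm $\|\cdot\|_\omega$, i.e. $D_\Phi(x,y)\ge\frac12\|x-y\|_\omega^2$. Let $\{u^k\}$ be generated from $u^0=u_0$ by the mirror descent iteration $$\nabla\Phi(u^{k+1})=\nabla\Phi(u^k)-\eta\big(\nabla f(u^k)+A^\top c(u^k)\big),\qquad k\ge 0,$$ with stepsize $\eta>0$, where $c(u^k)\in\mathbb R^m$ is the unique vector such that $Au^{k+1}=b$. Then for every integer $K\ge 1$, $$f\left(\frac1K\sum_{k=0}^{K-1}u^k\right)-f(u^* )\le\frac{1}{\eta K}D_\Phi(u^*,u_0)+\frac1K\sum_{k=0}^{K-1}\frac{\eta}{2}\|\nabla f(u^k)+A^\top c(u^k)\|_{\omega,*}^2,$$ where $\|\cdot\|_{\omega,*}$ is the dual norm of $\|\cdot\|_\omega$.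
   Context: Setting: $\Omega\subset\mathbb R^n$ is convex, $f:\Omega\to\mathbb R$ is a convex differentiable function, $A\in\mathbb R^{m\times n}$, $b\in\mathbb R^m$ ($m\ge 0$; $m=0$ means no constraint). The problem $\min_{u\in\Omega:\,Au=b} f(u)$ is assumed to have a unique solution $u^*$. $\Phi:\Omega\to\mathbb R$ is differentiable, with Bregman divergence $D_\Phi(x,y)=\Phi(x)-\Phi(y)-\nabla\Phi(y)^\top(x-y)$. The iterates lie in $\Omega$ and the initial point satisfies $Au_0=b$. *)

(* Defs.v *)
From HB Require Import structures.
From mathcomp Require Import all_boot all_order all_algebra.
From mathcomp Require Import all_classical all_reals all_analysis.
Set Implicit Arguments.
Unset Strict Implicit.
Unset Printing Implicit Defensive.
Import Order.TTheory GRing.Theory Num.Theory.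
Import numFieldNormedType.Exports.
Local Open Scope classical_set_scope.
Local Open Scope ring_scope.

Section Defs.
Context {R : realType}.

Definition dot {n : nat} (x y : 'cV[R]_n) : R := (x^T *m y) 0 0.

(* g is a gradient of f at x when only the values of f on Omega are used:
   f y = f x + g^T (y - x) + o(y - x) as y tends to x inside Omega.  The set
   Omega need not be open; is_gradient_interior shows that at interior points
   this is Frechet differentiability together with g being the usual gradient. *)
Definition is_gradient {n : nat} (Omega : set 'cV[R]_n) (f : 'cV[R]_n -> R)
    (x g : 'cV[R]_n) : Prop :=
  forall e : R, 0 < e -> \forall y \near within Omega (nbhs x),
    `|f y - f x - dot g (y - x)| <= e * `|y - x|.

(* gradf is only constrained on Omega. *)
Definition differentiable_on {n : nat} (Omega : set 'cV[R]_n)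
    (f : 'cV[R]_n -> R) (gradf : 'cV[R]_n -> 'cV[R]_n) : Prop :=
  forall x, Omega x -> is_gradient Omega f x (gradf x).

Definition bregman {n : nat} (Phi : 'cV[R]_n -> R)
    (gradPhi : 'cV[R]_n -> 'cV[R]_n) (x y : 'cV[R]_n) : R :=
  Phi x - Phi y - dot (gradPhi y) (x - y).

(* An arbitrary norm on R^n, as opposed to the sup norm `|x| that the library
   attaches to matrices and that only serves to define the topology. *)
Record is_norm {n : nat} (N : 'cV[R]_n -> R) : Prop := IsNorm {
  is_normD : forall x y, N (x + y) <= N x + N y;
  is_normZ : forall a x, N (a *: x) = `|a| * N x;
  is_norm_eq0 : forall x, N x = 0 -> x = 0 }.

Definition dual_norm {n : nat} (N : 'cV[R]_n -> R) (g : 'cV[R]_n) : R :=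
  sup [set dot g x | x in [set x | N x <= 1]].

Definition strongly_convex1 {n : nat} (Omega : set 'cV[R]_n)
    (N : 'cV[R]_n -> R) (Phi : 'cV[R]_n -> R)
    (gradPhi : 'cV[R]_n -> 'cV[R]_n) : Prop :=
  forall x y, Omega x -> Omega y ->
    2^-1 * N (x - y) ^+ 2 <= bregman Phi gradPhi x y.

Definition is_minimizer {n : nat} (S : set 'cV[R]_n) (f : 'cV[R]_n -> R)
    (x : 'cV[R]_n) : Prop :=
  S x /\ forall y, S y -> f x <= f y.

Definition mirror_step {m n : nat} (gradf gradPhi : 'cV[R]_n -> 'cV[R]_n)
    (A : 'M[R]_(m, n)) (eta : R) (u : 'cV[R]_n) (c : 'cV[R]_m)
    (v : 'cV[R]_n) : Prop :=
  gradPhi v = gradPhi u - eta *: (gradf u + A^T *m c).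

(* The last clause is the uniqueness of c (u k): a multiplier whose step from
   u k can be completed by a point of Omega satisfying the constraint is
   c (u k). *)
Definition mirror_descent {m n : nat} (Omega : set 'cV[R]_n)
    (gradf gradPhi : 'cV[R]_n -> 'cV[R]_n) (A : 'M[R]_(m, n)) (b : 'cV[R]_m)
    (eta : R) (u0 : 'cV[R]_n) (c : 'cV[R]_n -> 'cV[R]_m)
    (u : nat -> 'cV[R]_n) : Prop :=
  [/\ u 0%N = u0,
      forall k, Omega (u k),
      forall k, mirror_step gradf gradPhi A eta (u k) (c (u k)) (u k.+1),
      forall k, A *m u k.+1 = b
    & forall k c' v, Omega v ->
        mirror_step gradf gradPhi A eta (u k) c' v -> A *m v = b ->
        c' = c (u k)].

Let dot_linear {n : nat} (g : 'cV[R]_n) : linear (dot g : 'cV[R]_n -> R^o).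
Proof. by move=> a v w; rewrite /dot mulmxDr -scalemxAr !mxE. Qed.

HB.instance Definition _ {n : nat} (g : 'cV[R]_n) :=
  GRing.isLinear.Build R 'cV[R]_n R^o *:%R (dot g) (dot_linear g).

Lemma continuous_dot {n : nat} (g : 'cV[R]_n) :
  continuous (dot g : 'cV[R]_n -> R^o).
Proof.
pose F i : 'cV[R]_n -> R^o := fun w => g i 0 * w i 0.
have -> : dot g = \sum_i F i.
  apply/funext => w; rewrite /dot mxE fct_sumE.
  by apply: eq_bigr => i _; rewrite mxE.
apply: (big_ind (fun h : 'cV[R]_n -> R^o => continuous h)).
- exact: cst_continuous.
- by move=> h1 h2 c1 c2 v; apply: continuousD; [exact: c1 | exact: c2].
- move=> i _ v; apply: (@continuousM R^o); first exact: cst_continuous.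
  exact: coord_continuous.
Qed.

Lemma is_gradient_interior {n : nat} (Omega : set 'cV[R]_n)
    (f : 'cV[R]_n -> R) (x g : 'cV[R]_n) : interior Omega x ->
  is_gradient Omega f x g <->
  differentiable (f : 'cV[R]_n -> R^o) x /\
  forall v, 'd (f : 'cV[R]_n -> R^o) x v = dot g v.
Proof.
move=> /within_interior Ox; rewrite /is_gradient Ox.
set fo : 'cV[R]_n -> R^o := f.
pose L : {linear 'cV[R]_n -> R^o} := dot g.
have E : (forall e : R, 0 < e -> \forall y \near x,
      `|f y - f x - dot g (y - x)| <= e * `|y - x|) <->
    fo \o shift x = cst (fo x) + L +o_ (0 : 'cV[R]_n) id.
  split=> [H|/eqaddoP H].
    apply/eqaddoP => e e0.
    have := H e e0; rewrite (near_shift 0) subr0; apply: filterS => y /=.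
    by rewrite !fctE /= !addrK opprD addrA.
  move=> e e0; rewrite (near_shift 0) subr0.
  apply: filterS (H e e0) => y /=.
  by rewrite !fctE /= !addrK opprD addrA.
split=> [/E Hg|[df dg]].
  have dL : 'd fo x = L :> (_ -> _).
    by apply: diff_unique; [exact: continuous_dot|].
  split; last by move=> v; rewrite dL.
  apply/diff_locallyP; rewrite dL; split=> //; exact: continuous_dot.
have dL : 'd fo x = L :> (_ -> _) by apply/funext.
by apply/E; have /diff_locallyP[_] := df; rewrite dL.
Qed.

End Defs.

(* Main.v *)
Require Import Defs.
From mathcomp Require Import all_boot all_order all_algebra.
From mathcomp Require Import all_classical all_reals all_analysis.
From mathcomp Require Import ring lra.
Set Implicit Arguments.
Unset Strict Implicit.
Unset Printing Implicit Defensive.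
Import Order.TTheory GRing.Theory Num.Theory.
Import numFieldNormedType.Exports.
Local Open Scope classical_set_scope.
Local Open Scope ring_scope.

(** Write g_k = gradf (u k) + A^T c (u k).  Each u k and ustar solve A x = b, so
    u k - ustar lies in the kernel of A, to which A^T c (u k) is orthogonal:
    the multiplier is invisible in the pairing with u k - ustar, and convexity
    of f gives f (u k) - f ustar <= <g_k, u k - ustar>
    ([convex_gradient_le]).

    The right-hand side is bounded by the usual mirror descent argument
    ([mirror_step_regret]).  Since eta g_k is the decrease of gradPhi along the
    step, the three-point identity of Bregman divergences
    ([bregman_three_points]) turns eta <g_k, u k.+1 - ustar> into
    D(ustar, u k) - D(ustar, u k.+1) - D(u k.+1, u k).  What is left,
    eta <g_k, u k - u k.+1>, is at most
    eta^2/2 ||g_k||_*^2 + 1/2 ||u k - u k.+1||^2 by duality and Young's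
    inequality, and strong convexity of Phi cancels the last square against
    D(u k.+1, u k).  Summing over k telescopes the divergences, D(ustar, u K)
    is nonnegative, and Jensen's inequality ([convex_mean_le]) passes from the
    mean of the values f (u k) to the value of f at the mean iterate.

    The duality inequality <g, x> <= ||g||_* ||x|| ([dot_le_dual_norm]) is
    where the finite dimension enters.  The dual norm is a supremum over the
    unit ball, so it bounds the pairing only if the pairing is bounded there;
    this follows from the comparison of an arbitrary norm with the sup norm
    ([mx_norm_le_is_norm]), itself a consequence of the compactness of the
    sup-norm unit sphere. *)

(** * The pairing *)

Lemma dotC (R : realType) (n : nat) (x y : 'cV[R]_n) : dot x y = dot y x.
Proof. by rewrite /dot !mxE; apply: eq_bigr => i _; rewrite !mxE mulrC. Qed.

Lemma dotDl (R : realType) (n : nat) (g h x : 'cV[R]_n) :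
  dot (g + h) x = dot g x + dot h x.
Proof. by rewrite dotC linearD/= !(dotC x). Qed.

Lemma dotBl (R : realType) (n : nat) (g h x : 'cV[R]_n) :
  dot (g - h) x = dot g x - dot h x.
Proof. by rewrite dotC linearB/= !(dotC x). Qed.

Lemma dotBr (R : realType) (n : nat) (g x y : 'cV[R]_n) :
  dot g (x - y) = dot g x - dot g y.
Proof. by rewrite linearB. Qed.

Lemma dotZr (R : realType) (n : nat) (a : R) (g x : 'cV[R]_n) :
  dot g (a *: x) = a * dot g x.
Proof. by rewrite linearZ. Qed.

Lemma dotZl (R : realType) (n : nat) (a : R) (g x : 'cV[R]_n) :
  dot (a *: g) x = a * dot g x.
Proof. by rewrite dotC dotZr dotC. Qed.

Lemma dot_trmx_mul (R : realType) (m n : nat) (A : 'M[R]_(m, n))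
    (c : 'cV[R]_m) (x : 'cV[R]_n) : dot (A^T *m c) x = dot c (A *m x).
Proof. by rewrite /dot trmx_mul trmxK mulmxA. Qed.

(** * Convexity *)

Lemma convex_set_comb (R : realType) (n : nat) (Omega : set 'cV[R]_n) :
  convex_set Omega -> forall (t : R) (x y : 'cV[R]_n),
  0 <= t -> t <= 1 -> Omega x -> Omega y -> Omega (t *: x + (1 - t) *: y).
Proof.
move=> cO t x y t0 t1 Ox Oy.
by have := cO x y (Itv01 t0 t1) (mem_set Ox) (mem_set Oy) => /set_mem.
Qed.

Lemma convex_function_comb (R : realType) (n : nat) (Omega : set 'cV[R]_n)
    (f : 'cV[R]_n -> R) :
  convex_function Omega f -> forall (t : R) (x y : 'cV[R]_n),
  0 <= t -> t <= 1 -> Omega x -> Omega y ->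
  f (t *: x + (1 - t) *: y) <= t * f x + (1 - t) * f y.
Proof.
move=> cf t x y t0 t1 Ox Oy.
exact: (cf (Itv01 t0 t1) x y (mem_set Ox) (mem_set Oy)).
Qed.

(** The mean of K+2 points is the combination, with weight t = (K+1)/(K+2), of
    the mean of the first K+1 points and of the last one. *)
Lemma convex_set_mean (R : realType) (n : nat) (Omega : set 'cV[R]_n)
    (u : nat -> 'cV[R]_n) :
  convex_set Omega -> (forall k, Omega (u k)) ->
  forall K, (0 < K)%N -> Omega (K%:R^-1 *: \sum_(k < K) u k).
Proof.
move=> cO Ou [//|K] _; elim: K => [|K IH].
  by rewrite big_ord1 invr1 scale1r.
pose t : R := K.+1%:R / K.+2%:R.
have K2 : 0 < K.+2%:R :> R by rewrite ltr0n.
have K1 : 0 < K.+1%:R :> R by rewrite ltr0n.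
have onemt : 1 - t = K.+2%:R^-1.
  rewrite /t; apply: (mulIf (lt0r_neq0 K2)).
  by rewrite mulrBl mul1r mulVf ?divfK ?lt0r_neq0// -natrB// subSnn.
have := convex_set_comb cO (t := t) _ _ IH (Ou K.+1).
rewrite onemt scalerA {2}/t mulrAC divff ?lt0r_neq0// mul1r -scalerDr.
rewrite [\sum_(k < K.+2) _]big_ord_recr/=; apply.
  by rewrite divr_ge0.
by rewrite ler_pdivrMr// mul1r ler_nat.
Qed.

(** Along the segment z = x + t (y - x), convexity gives
    f z - f x <= t (f y - f x), while f z - f x = t <g, y - x> + o(t) as t tends
    to 0; divide by t.  The segment stays in Omega, so a gradient relative to
    Omega suffices and x may be a boundary point. *)
Lemma convex_gradient_le (R : realType) (n : nat) (Omega : set 'cV[R]_n)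
    (f : 'cV[R]_n -> R) (x y g : 'cV[R]_n) :
  convex_set Omega -> convex_function Omega f -> is_gradient Omega f x g ->
  Omega x -> Omega y -> dot g (y - x) <= f y - f x.
Proof.
move=> cO cf gf Ox Oy; apply/ler_addgt0Pr => e e0.
(* Adding 1 to the distance avoids a case analysis on y = x. *)
have D0 : 0 < `|y - x| + 1 by rewrite ltr_wpDl.
have /gf : 0 < e / (`|y - x| + 1) by rewrite divr_gt0.
rewrite near_withinE => /nbhs_normP[d /= d0 Hd].
pose t := Num.min 1 (d / (`|y - x| + 1)).
have t0 : 0 < t by rewrite lt_min ltr01 divr_gt0.
have t1 : t <= 1 by rewrite ge_min lexx.
have zE : t *: y + (1 - t) *: x = x + t *: (y - x).
  by rewrite scalerBr scalerBl scale1r addrCA.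
have Oz := convex_set_comb cO (ltW t0) t1 Oy Ox.
have fz := convex_function_comb cf (ltW t0) t1 Oy Ox.
rewrite zE in Oz fz.
have td : t * `|y - x| < d.
  have tle : t <= d / (`|y - x| + 1) by rewrite ge_min lexx orbT.
  have := ler_wpM2r (ltW D0) tle; rewrite divfK ?lt0r_neq0//.
  by apply: lt_le_trans; rewrite mulrDr mulr1 ltrDl.
have := Hd (x + t *: (y - x)); rewrite /= opprD addrA subrr add0r normrN.
rewrite normrZ gtr0_norm// => /(_ td Oz).
rewrite (addrAC x) subrr add0r normrZ gtr0_norm// dotZr ler_norml => /andP[+ _].
set N := `|y - x| in D0 *; set q := e / (N + 1) => lo.
have qN : q * N <= e.
  by rewrite /q mulrAC ler_pdivrMr// ler_wpM2l ?(ltW e0)// lerDl.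
rewrite -(ler_pM2l t0).
have : t * (q * N) <= t * e by rewrite ler_wpM2l// ltW.
move: lo fz; set a := f (x + _); lra.
Qed.

(** Jensen's inequality for equal weights, by summing the tangent inequalities
    at the mean x: their linear parts add up to <gradf x, K x - K x> = 0. *)
Lemma convex_mean_le (R : realType) (n : nat) (Omega : set 'cV[R]_n)
    (f : 'cV[R]_n -> R) (gradf : 'cV[R]_n -> 'cV[R]_n) (u : nat -> 'cV[R]_n) :
  convex_set Omega -> convex_function Omega f ->
  differentiable_on Omega f gradf -> (forall k, Omega (u k)) ->
  forall K, (0 < K)%N ->
  f (K%:R^-1 *: \sum_(k < K) u k) <= K%:R^-1 * \sum_(k < K) f (u k).
Proof.
move=> cO cf df Ou K K0; set x := K%:R^-1 *: \sum_(k < K) u k.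
have KR : 0 < K%:R :> R by rewrite ltr0n.
have Ox : Omega x by exact: (convex_set_mean cO Ou K0).
rewrite ler_pdivlMl//.
have : \sum_(k < K) dot (gradf x) (u k - x) <= \sum_(k < K) (f (u k) - f x).
  apply: ler_sum => k _.
  exact: (convex_gradient_le cO cf (df _ Ox) Ox (Ou k)).
have -> : \sum_(k < K) dot (gradf x) (u k - x) = 0.
  transitivity (dot (gradf x) (\sum_(k < K) (u k - x))).
    by rewrite [RHS]linear_sum.
  rewrite sumrB sumr_const card_ord -scaler_nat /x scalerA.
  by rewrite divff ?lt0r_neq0// scale1r subrr linear0.
by rewrite sumrB subr_ge0 sumr_const card_ord mulr_natl.
Qed.

(** * Norms and dual norms *)

Section Norm.
Context {R : realType} {n : nat} {N : 'cV[R]_n -> R} (normN : is_norm N).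

Lemma is_norm0 : N 0 = 0.
Proof. by rewrite -(scale0r 0) (is_normZ normN) normr0 mul0r. Qed.

Lemma is_normN x : N (- x) = N x.
Proof. by rewrite -scaleN1r (is_normZ normN) normrN1 mul1r. Qed.

Lemma is_norm_ge0 x : 0 <= N x.
Proof. have := is_normD normN x (- x); rewrite subrr is_norm0 is_normN; lra. Qed.

Lemma is_norm_sum (I : Type) (r : seq I) (F : I -> 'cV[R]_n) :
  N (\sum_(i <- r) F i) <= \sum_(i <- r) N (F i).
Proof.
elim/big_rec2 : _ => [|i y x _ le_xy]; first by rewrite is_norm0.
by rewrite (le_trans (is_normD normN _ _))// lerD2l.
Qed.

Lemma is_norm_lipschitz x y : `|N x - N y| <= N (x - y).
Proof.
have := is_normD normN (x - y) y; have := is_normD normN (y - x) x.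
rewrite !subrK -[N (y - x)]is_normN opprB ler_norml; lra.
Qed.

Lemma coord_le_norm (w : 'rV[R]_n) i : `|w 0 i| <= `|w|.
Proof.
rewrite [leRHS]/Num.Def.normr/= mx_normrE; apply/bigmax_geP; right.
by exists (0, i).
Qed.

Lemma is_norm_le_mx_norm : exists2 C, 0 < C &
  forall w : 'rV[R]_n, N w^T <= C * `|w|.
Proof.
exists (\sum_i N (delta_mx 0 i)^T + 1).
  by rewrite ltr_wpDl// sumr_ge0// => i _; exact: is_norm_ge0.
move=> w; rewrite {1}[w]row_sum_delta linear_sum/=.
apply: le_trans (is_norm_sum _ _) _.
rewrite mulrDl mulr_suml mul1r -[leLHS]addr0 lerD// ler_sum// => i _.
rewrite linearZ/= (is_normZ normN) mulrC ler_wpM2l ?is_norm_ge0//.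
exact: coord_le_norm.
Qed.

(** Continuity for the sup-norm topology, which is what the extreme value
    theorem on the unit sphere below requires. *)
Lemma is_norm_continuous : continuous (fun w : 'rV[R]_n => N w^T : R^o).
Proof.
have [C C0 NC] := is_norm_le_mx_norm.
move=> w; apply/(@cvgrPdist_le _ _ _ (nbhs w)) => e e0.
apply: (filterS _ (nbhsx_ballx w (C^-1 * e) _)).
  2: by rewrite mulr_gt0// invr_gt0.
move=> v; rewrite mx_norm_ball /ball_/= => wv.
apply: le_trans (is_norm_lipschitz _ _) _.
by rewrite -linearB/= (le_trans (NC _))// -ler_pdivlMl// ltW.
Qed.

(** The constant is the minimum of N over the unit sphere of the sup norm; it is
    positive because N vanishes only at 0.  Vectors are transposed because the
    Heine-Borel theorem, which gives the compactness of the sphere, is stated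
    for row vectors. *)
Lemma mx_norm_le_is_norm : exists2 k, 0 < k &
  forall w : 'rV[R]_n, k * `|w| <= N w^T.
Proof.
pose S := [set w : 'rV[R]_n | `|w| = 1].
have normalize (w : 'rV[R]_n) : w != 0 -> S (`|w|^-1 *: w).
  move=> w0; rewrite /S/= normrZ normfV normr_id mulVf// normr_eq0//.
(* The sphere is empty when n = 0; then every vector is 0 and any constant
   will do. *)
have [S0|S0] := pselect (S !=set0); last first.
  exists 1 => // w; have [->|/normalize Sw] := eqVneq w 0.
    by rewrite normr0 mulr0 is_norm_ge0.
  by case: S0; exists (`|w|^-1 *: w).
have cS : compact S.
  apply: bounded_closed_compact.
    by exists 1; split=> // M M1 w /= ->; exact: ltW.
  apply: (@preimage_closed _ _ (Num.Def.normr : 'rV[R]_n -> R^o)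
    [set x | x = 1]).
    by move=> w _; exact: norm_continuous.
  exact: closed_eq.
have [s /set_mem Ss mins] :=
  EVT_min_rV S0 cS (continuous_subspaceT is_norm_continuous).
have Ns : 0 < N s^T.
  rewrite lt_neqAle is_norm_ge0 andbT eq_sym.
  apply/eqP => /(is_norm_eq0 normN)/(congr1 trmx); rewrite trmxK trmx0 => s0.
  by move: Ss; rewrite /S/= s0 normr0 => /esym/eqP; rewrite oner_eq0.
exists (N s^T) => // w; have [->|w0] := eqVneq w 0.
  by rewrite normr0 mulr0 is_norm_ge0.
have := mins _ (mem_set (normalize _ w0)).
rewrite linearZ/= (is_normZ normN) normfV normr_id.
by rewrite ler_pdivlMl ?normr_gt0// mulrC.
Qed.

(** Without this bound the supremum defining the dual norm would carry the
    default value 0, and the duality inequality would fail. *)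
Lemma dual_norm_has_ubound g :
  has_ubound [set dot g x | x in [set x | N x <= 1]].
Proof.
have [k k0 Nk] := mx_norm_le_is_norm.
exists ((\sum_i `|g i 0|) / k) => _ [x /= Nx <-].
have xk : `|x^T| <= k^-1.
  have := Nk x^T; rewrite trmxK -ler_pdivlMl// => /le_trans; apply.
  by rewrite -[leRHS]mulr1 ler_wpM2l// invr_ge0 ltW.
rewrite /dot mxE mulr_suml ler_sum// => i _; rewrite mxE.
apply: le_trans (ler_norm _) _; rewrite normrM ler_wpM2l//.
apply: le_trans xk; have := coord_le_norm x^T i.
by rewrite mxE.
Qed.

Lemma dot_le_dual_norm g x : dot g x <= dual_norm N g * N x.
Proof.
have [Nx0|Nx0] := eqVneq (N x) 0.
  by rewrite Nx0 mulr0 (is_norm_eq0 normN Nx0) linear0.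
have Nx : 0 < N x by rewrite lt_neqAle eq_sym Nx0 is_norm_ge0.
rewrite -ler_pdivrMr// mulrC -dotZr.
apply: (ub_le_sup (dual_norm_has_ubound g)); exists ((N x)^-1 *: x) => //=.
by rewrite (is_normZ normN) normfV gtr0_norm// mulVf.
Qed.

End Norm.

(** * Mirror descent *)

Lemma bregman_three_points (R : realType) (n : nat) (Phi : 'cV[R]_n -> R)
    (gradPhi : 'cV[R]_n -> 'cV[R]_n) (p u v : 'cV[R]_n) :
  dot (gradPhi u - gradPhi v) (v - p) =
  bregman Phi gradPhi p u - bregman Phi gradPhi p v - bregman Phi gradPhi v u.
Proof. by rewrite /bregman !dotBl !dotBr; ring. Qed.

(** Split u - p as (u - v) + (v - p): the second part is the three-point
    identity, and the first one is paid for by strong convexity through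
    a N <= a^2/2 + N^2/2, with a = eta ||g||_* and N = ||u - v||. *)
Lemma mirror_step_regret (R : realType) (n : nat) (Omega : set 'cV[R]_n)
    (normw : 'cV[R]_n -> R) (Phi : 'cV[R]_n -> R)
    (gradPhi : 'cV[R]_n -> 'cV[R]_n) (eta : R) (g p u v : 'cV[R]_n) :
  is_norm normw -> strongly_convex1 Omega normw Phi gradPhi -> 0 <= eta ->
  Omega u -> Omega v -> gradPhi v = gradPhi u - eta *: g ->
  eta * dot g (u - p) <=
  bregman Phi gradPhi p u - bregman Phi gradPhi p v
  + eta ^+ 2 / 2 * dual_norm normw g ^+ 2.
Proof.
move=> normN sc eta0 Ou Ov step.
have := bregman_three_points Phi gradPhi p u v.
rewrite step opprB addrCA subrr addr0 dotZl => tp.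
have -> : u - p = (u - v) + (v - p) by rewrite addrA subrK.
rewrite linearD/= mulrDr tp.
have := sc v u Ov Ou; rewrite -(is_normN normN) opprB => scvu.
have := ler_wpM2l eta0 (dot_le_dual_norm normN g (u - v)) => gd.
have : 0 <= (eta * dual_norm normw g - normw (u - v)) ^+ 2 by exact: sqr_ge0.
move: scvu gd; set d := dual_norm _ _; set N := normw _.
set B1 := bregman _ _ p u; set B2 := bregman _ _ p v; set B3 := bregman _ _ v u.
rewrite !expr2; nra.
Qed.

Unset Implicit Arguments.

Theorem theorem3 (R : realType) (m n : nat)
    (Omega : set 'cV[R]_n) (f Phi : 'cV[R]_n -> R)
    (gradf gradPhi : 'cV[R]_n -> 'cV[R]_n)
    (A : 'M[R]_(m, n)) (b : 'cV[R]_m) (ustar u0 : 'cV[R]_n)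
    (normw : 'cV[R]_n -> R) (eta : R)
    (c : 'cV[R]_n -> 'cV[R]_m) (u : nat -> 'cV[R]_n) :
  convex_set Omega ->
  convex_function Omega f ->
  differentiable_on Omega f gradf ->
  unique (is_minimizer [set v | Omega v /\ A *m v = b] f) ustar ->
  differentiable_on Omega Phi gradPhi ->
  is_norm normw ->
  strongly_convex1 Omega normw Phi gradPhi ->
  0 < eta ->
  A *m u0 = b ->
  mirror_descent Omega gradf gradPhi A b eta u0 c u ->
  forall K : nat, (1 <= K)%N ->
    f (K%:R^-1 *: \sum_(k < K) u k) - f ustar <=
      (eta * K%:R)^-1 * bregman Phi gradPhi ustar u0 +
      K%:R^-1 * \sum_(k < K)
        (eta / 2 * dual_norm normw (gradf (u k) + A^T *m c (u k)) ^+ 2).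
Proof.
move=> cO cf df [[[Os As] _] _] _ normN sc eta0 Au0 [u00 Ou step Au _] K K1.
have Auk k : A *m u k = b by case: k => [|k]; rewrite ?u00.
pose D k := bregman Phi gradPhi ustar (u k).
pose E k := eta / 2 * dual_norm normw (gradf (u k) + A^T *m c (u k)) ^+ 2.
have regret k : f (u k) - f ustar <= eta^-1 * (D k - D k.+1) + E k.
  (* The multiplier contributes <c (u k), A u k - A ustar>, and both images
     are b. *)
  have lin : f (u k) - f ustar <=
      dot (gradf (u k) + A^T *m c (u k)) (u k - ustar).
    rewrite dotDl dot_trmx_mul mulmxBr Auk As subrr linear0 addr0.
    have := convex_gradient_le cO cf (df _ (Ou k)) (Ou k) Os.
    by rewrite !dotBr; lra.
  apply: le_trans lin _.
  have := mirror_step_regret ustar normN sc (ltW eta0)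
    (Ou k) (Ou k.+1) (step k).
  rewrite -ler_pdivlMl// => /le_trans; apply.
  rewrite mulrDr -/(D k) -/(D k.+1) lerD2l /E.
  rewrite le_eqVlt; apply/orP; left; apply/eqP; field.
  exact: lt0r_neq0.
have DK : 0 <= D K.
  by apply: le_trans (sc _ _ Os (Ou K)); rewrite mulr_ge0// sqr_ge0.
have KR : 0 < K%:R :> R by rewrite ltr0n.
have sum_regret : \sum_(k < K) (f (u k) - f ustar) <=
    eta^-1 * D 0%N + \sum_(k < K) E k.
  apply: le_trans (ler_sum _ (fun (k : 'I_K) _ => regret k)) _.
  rewrite big_split/= -mulr_sumr lerD2r ler_wpM2l ?invr_ge0 ?(ltW eta0)//.
  rewrite -(big_mkord xpredT (fun k => D k - D k.+1)).
  under eq_bigr do rewrite -opprB.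
  by rewrite sumrN telescope_sumr// opprB gerBl.
have := convex_mean_le cO cf df Ou K1.
rewrite -(lerD2r (- f ustar)) => /le_trans; apply.
have -> : f ustar = K%:R^-1 * \sum_(k < K) f ustar.
  rewrite sumr_const card_ord -[f ustar *+ K]mulr_natl mulrA.
  by rewrite mulVf ?mul1r// lt0r_neq0.
rewrite -mulrBr -sumrB invfM -u00 [eta^-1 * _]mulrC -mulrA -mulrDr.
by rewrite ler_pM2l ?invr_gt0.
Qed.
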